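(* Let $G$ be a finite simple undirected graph and let $(G_i)_{i\ge 1}$ be its clean-factor series, with levels $V_0,V_1,V_2,\ldots$. Then for every $k\ge 2$, the map $\phi$ defined by $x\mapsto S(x)$, where $S(x)=(O_1(x),\ldots,O_{k-1}(x))$ is the characterising sequence of $x\in V_k$, is a bijection from $V_k$ to $$\{(O_1,\ldots,O_{k-1})\in\mathcal{O}^{k-1} \mid O_1\subsetneq O_2\subsetneq\cdots\subsetneq O_{k-1}\}.$$
   Context: All graphs are finite, undirected and simple. A $k$-partite graph $G=(V_0,\ldots,V_{k-1},E)$ is a graph together with an ordered partition $(V_0,\ldots,V_{k-1})$ of its vertex set into $k$ non-empty parts (levels) such that every edge joins vertices in different parts. $N(x)$ is the neighbourhood of $x$ and $N_i(x)=N(x)\cap V_i$. Factorisation. Given a $k$-partite graph $G=(V_0,\ldots,V_{k-1},E)$ with $k\ge 2$ and a set $V'_k$ of subsets of $V(G)$, the factorisation of $G$ with respect to $V'_k$ is the graph $G'=(V_0,\ldots,V_k,E\cup E_+)$, where the new level $V_k$ is the set of inclusion-maximal elements of $V'_k$ and $E_+=\{Xy \mid X\in V_k,\ y\in X\}$. It is called effective if $V_k\neq\emptyset$. The set $V^+_k$. For a $k$-partite graph, $V^+_k$ is the set of all sets $\{x_1,\ldots,x_l\}\cup\bigcap_{1\le i\le l}N(x_i)$ where $l\ge 2$, $x_1,\ldots,x_l$ are distinct elements of $V_{k-1}$, and $|\bigcap_{1\le i\le l}N(x_i)|\ge 2$. The set $V^*_k$. - If $k\ge 5$: $V^*_k$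 is the set of $X\in V^+_k$ such that $|\bigcap_{x\in X\cap V_{k-1}}N_{k-2}(x)|\ge 2$, and $N_{k-3}(x)=N_{k-3}(y)$ for all $x,y\in X\cap V_{k-1}$, and $|\bigcap_{x\in X\cap V_{k-1}}N_1(x)|\ge 2$. - If $k=4$: $V^*_4$ is the set of $X\in V^+_4$ such that $|\bigcap_{x\in X\cap V_3}N_2(x)|\ge 2$, $|\bigcap_{x\in X\cap V_3}N_1(x)|\ge 2$, and $N_0(x)=N_0(y)$ for all $x,y\in X\cap V_3$. - If $k=3$: $V^*_3$ is the set of $X\in V^+_3$ such that $|\bigcap_{x\in X\cap V_2}N_1(x)|\ge 2$ and $|\bigcap_{x\in X\cap V_2}N_0(x)|\ge 2$. - If $k=2$: $V^*_2=V^+_2$. The clean-factor graph of a $k$-partite graph is its factorisation with respect to $V^*_k$. Clean-factor series of a graph $G$. $\mathcal{K}(G)$ is the set of maximal cliques of $G$. $G_1=B(G)$ is the vertex-clique-incidence bipartite graph: level $V_0=V(G)$, level $V_1=\mathcal{K}(G)$, with an edge $vC$ whenever $v\in C$. For $i\ge 1$, $G_{i+1}$ is the clean-factor graph of $G_i$ if that factorisation is effective, and is undefined otherwise. Each step adds one new level, so $G_i$ has levels $V_0,\ldots,V_i$; when the series stops before level $V_k$ is created, $V_k$ is taken to be empty. Intersections of cliques. $\mathcal{O}'=\{O\subseteq V(G) \mid \exists P\subseteq\mathcal{K}(G),\ O=\bigcap_{C\in P}C\}$ with the convention $\bigcap_{C\in\varnothing}C=V(G)$. $\mathcal{O}$ is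 the set of $O\in\mathcal{O}'$ with $|O|\ge 2$ that can be written as the intersection of at least two pairwise distinct maximal cliques of $G$. For $A\subseteq V(G)$, $K(A)=\{C\in\mathcal{K}(G) \mid A\subseteq C\}$. Characterising sequence. For $k\ge 2$ and $x\in V_k$, $S(x)=(O_1(x),\ldots,O_{k-1}(x))$, where $O_1(x)=N_0(x)$ and, for $k\ge 3$ and each $j$ with $2\le j\le k-1$, $O_j(x)$ is the unique element of $\mathcal{O}'$ such that $K(O_j(x))=\bigcap_{y\in N_j(x)}N_1(y)$ (such an element exists and is unique; $V_1$ is identified with $\mathcal{K}(G)$). *)

(* Defs.v *)
From mathcomp Require Import all_boot.

Set Implicit Arguments.
Unset Strict Implicit.
Unset Printing Implicit Defensive.

(* Non-emptiness of the parts is not a field: it can only fail for part 0 of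
   the clean-factor series of the graph without vertices; see
   [clean_series_level_neq0]. *)
Record kpartite (k : nat) := KPartite {
  kvert :> finType;
  klevel : kvert -> 'I_k;
  kadj : rel kvert;
  kadj_sym : symmetric kadj;
  kadj_level : forall x y, kadj x y -> klevel x != klevel y
}.

Section Neighbourhoods.
Variables (k : nat) (G : kpartite k).

Definition lvl (i : nat) : {set G} := [set x | klevel x == i :> nat].

Definition nbh (x : G) : {set G} := [set y | kadj x y].

Definition nbh_lvl (i : nat) (x : G) : {set G} := nbh x :&: lvl i.

End Neighbourhoods.

Section Factorisation.
Variables (k : nat) (G : kpartite k) (W : {set {set G}}).

Definition max_elements : {set {set G}} := [set X | maxset [in W] X].

Definition effective : bool := max_elements != set0.

Definition fact_vert : finType := (G + {X : {set G} | X \in max_elements})%type.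

Definition fact_level (u : fact_vert) : 'I_k.+1 :=
  match u with
  | inl x => widen_ord (leqnSn k) (klevel x)
  | inr _ => ord_max
  end.

Definition fact_adj (u v : fact_vert) : bool :=
  match u, v with
  | inl x, inl y => kadj x y
  | inl y, inr X => y \in val X
  | inr X, inl y => y \in val X
  | inr _, inr _ => false
  end.

Lemma fact_adj_sym : symmetric fact_adj.
Proof. by move=> [x|X] [y|Y] //=; apply: kadj_sym. Qed.

Lemma fact_adj_level u v : fact_adj u v -> fact_level u != fact_level v.
Proof.
case: u v => [x|X] [y|Y] //= => [/kadj_level//|_|_]; rewrite -val_eqE /=.
- by rewrite neq_ltn ltn_ord.
- by rewrite neq_ltn ltn_ord orbT.
Qed.

Definition factorisation : kpartite k.+1 := KPartite fact_adj_sym fact_adj_level.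

End Factorisation.

Section CleanFactor.
Variables (k : nat) (G : kpartite k).

Definition Vplus : {set {set G}} :=
  [set X | [exists A : {set G},
     [&& A \subset lvl G k.-1, 2 <= #|A|, 2 <= #|\bigcap_(x in A) nbh x|
       & X == A :|: \bigcap_(x in A) nbh x]]].

Definition common_nbh_lvl (i : nat) (X : {set G}) : {set G} :=
  \bigcap_(x in X :&: lvl G k.-1) nbh_lvl i x.

Definition same_nbh_lvl (i : nat) (X : {set G}) : bool :=
  [forall x in X :&: lvl G k.-1, forall y in X :&: lvl G k.-1,
     nbh_lvl i x == nbh_lvl i y].

(* Meaningful for 2 <= k only. *)
Definition Vstar : {set {set G}} :=
  if 5 <= k then
    [set X in Vplus | [&& 2 <= #|common_nbh_lvl (k - 2) X|,
                          same_nbh_lvl (k - 3) X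
                        & 2 <= #|common_nbh_lvl 1 X|]]
  else if k == 4 then
    [set X in Vplus | [&& 2 <= #|common_nbh_lvl 2 X|,
                          2 <= #|common_nbh_lvl 1 X|
                        & same_nbh_lvl 0 X]]
  else if k == 3 then
    [set X in Vplus | (2 <= #|common_nbh_lvl 1 X|)
                      && (2 <= #|common_nbh_lvl 0 X|)]
  else Vplus.

Definition clean_factor : kpartite k.+1 := factorisation Vstar.

End CleanFactor.

Section Graph.
Variables (T : finType) (e : rel T).

Definition clique (C : {set T}) : bool :=
  [forall x in C, forall y in C, (x != y) ==> e x y].

Definition max_cliques : {set {set T}} := [set C | maxset clique C].

Definition mclique : finType := {C : {set T} | C \in max_cliques}.

Definition B_vert : finType := (T + mclique)%type.

Definition B_level (u : B_vert) : 'I_2 :=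
  match u with inl _ => ord0 | inr _ => ord_max end.

Definition B_adj (u v : B_vert) : bool :=
  match u, v with
  | inl x, inr C => x \in val C
  | inr C, inl x => x \in val C
  | _, _ => false
  end.

Lemma B_adj_sym : symmetric B_adj.
Proof. by move=> [x|C] [y|D]. Qed.

Lemma B_adj_level u v : B_adj u v -> B_level u != B_level v.
Proof. by case: u v => [x|C] [y|D]. Qed.

Definition B_graph : kpartite 2 := KPartite B_adj_sym B_adj_level.

(* A graph of the series, together with the inclusion of V_0 and V_1, i.e. of
   the vertices of B(G), into its vertices. *)
Record stage (k : nat) := Stage {
  stage_graph :> kpartite k;
  stage_base : B_graph -> stage_graph
}.

Definition next_stage k (H : stage k) : option (stage k.+1) :=
  if effective (Vstar H)
  then Some (@Stage k.+1 (clean_factor H)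
                    (fun u => inl (stage_base H u) : fact_vert (Vstar H)))
  else None.

(* [clean_series i] is G_i (None if undefined); the series starts at i = 1. *)
Fixpoint clean_series (i : nat) : option (stage i.+1) :=
  match i with
  | 0 => None
  | j.+1 =>
      match j return option (stage j.+1) -> option (stage j.+2) with
      | 0 => fun=> Some (Stage (fun u : B_graph => u))
      | _.+1 => obind (@next_stage _)
      end (clean_series j)
  end.

(* The level V_k, empty if the series stops before it is created. *)
Definition opt_level k (o : option (stage k.+1)) : Type :=
  if o is Some H then {x : H | x \in lvl H k} else void.

Definition series_level (k : nat) : Type := opt_level (clean_series k).

(* The intersection over the empty P is [set: T]. *)
Definition Oprime : {set {set T}} :=
  [set O | [exists P : {set {set T}},
     (P \subset max_cliques) && (O == \bigcap_(C in P) C)]].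

Definition Ocal : {set {set T}} :=
  [set O in Oprime | (2 <= #|O|) &&
     [exists P : {set {set T}},
        [&& P \subset max_cliques, 2 <= #|P| & O == \bigcap_(C in P) C]]].

Definition Kof (A : {set T}) : {set mclique} := [set C : mclique | A \subset val C].

(* N_0(x) and N_1(x) as a set of vertices, resp. of maximal cliques, of G. *)
Definition nbh_vertices k (H : stage k) (x : H) : {set T} :=
  [set v | stage_base H (inl v) \in nbh_lvl 0 x].

Definition nbh_cliques k (H : stage k) (x : H) : {set mclique} :=
  [set C | stage_base H (inr C) \in nbh_lvl 1 x].

(* The value set0, which is not in Ocal, is taken if there is no such O; at
   most one O qualifies by [Kof_inj]. *)
Definition the_O (S : {set mclique}) : {set T} :=
  odflt set0 [pick O in Oprime | Kof O == S].

Definition O_at k (H : stage k) (j : nat) (x : H) : {set T} :=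
  if j == 1 then nbh_vertices x
  else the_O (\bigcap_(y in nbh_lvl j x) nbh_cliques y).

Definition stage_charseq m (H : stage m) (k : nat) (x : H) :
    k.-1.-tuple {set T} :=
  [tuple O_at j.+1 x | j < k.-1].

Definition opt_charseq k (o : option (stage k.+1)) :
    opt_level o -> k.-1.-tuple {set T} :=
  match o with
  | Some H => fun x => stage_charseq k (val x)
  | None => fun x => match x with end
  end.

Definition charseq (k : nat) : series_level k -> k.-1.-tuple {set T} :=
  @opt_charseq k (clean_series k).

Definition O_chains (n : nat) : {set n.-tuple {set T}} :=
  [set s : n.-tuple {set T} | all [in Ocal] s && sorted (fun A B : {set T} => A \proper B) s].

Lemma Kof_inj : {in Oprime &, injective Kof}.
Proof.
have sub O1 O2 : O2 \in Oprime -> Kof O2 \subset Kof O1 -> O1 \subset O2.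
  rewrite inE => /existsP[P /andP[sP /eqP ->]] sK.
  apply/bigcapsP=> C CP; have CK := subsetP sP _ CP.
  have: Sub C CK \in Kof O1.
    by apply: (subsetP sK); rewrite inE /= bigcap_inf.
  by rewrite inE.
move=> O1 O2 O1P O2P eqK; apply/eqP; rewrite eqEsubset.
by rewrite !sub // eqK.
Qed.

Lemma clean_series_level_neq0 i (H : stage i.+1) (j : 'I_i.+1) :
  0 < #|T| -> clean_series i = Some H -> lvl H j != set0.
Proof.
move=> /card_gt0P[x0 _]; elim: i H j => [//|[|i] IH] H j.
  case=> <-; case: j => [[|[|j]] //= ltj].
    by apply/set0Pn; exists (inl x0); rewrite inE.
  have cl1: clique [set x0].
    by apply/forall_inP=> x /set1P-> /=; apply/forall_inP=> y /set1P->;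
       rewrite eqxx.
  have [C maxC _] := maxset_exists cl1.
  have CK : C \in max_cliques by rewrite inE.
  by apply/set0Pn; exists (inr (Sub C CK)); rewrite inE.
have -> : clean_series i.+2 = obind (@next_stage _) (clean_series i.+1) by [].
case E: (clean_series i.+1) => [H'|//] /=.
rewrite /next_stage; case: ifP => // /set0Pn[X XW] [<-] /=.
have [ltj|lej] := ltnP j i.+2.
  have /set0Pn[x] := IH H' (Ordinal ltj) E.
  by rewrite inE => /= xj; apply/set0Pn; exists (inl x); rewrite inE.
apply/set0Pn; exists (inr (Sub X XW)); rewrite inE /=.
by rewrite eqn_leq lej -ltnS ltn_ord.
Qed.

End Graph.

(* Main.v *)
(* A vertex of level k >= 2 is determined by its chain of intersections of
   cliques, and adjacency can be read off the chains: the lower neighbours of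
   s = (O_1, ..., O_k) are the vertices in O_1, the maximal cliques containing
   O_k, and the chains (O_1, ..., O_(j-1), S) with O_j <= S <= O_(j+1).  By
   induction on the level, each graph of the series is isomorphic to the graph
   on vertices, maximal cliques and chains so defined.  In the induction step,
   the set X_s of lower neighbours of a chain s of the next length is clean;
   the conditions defining V* force the top elements of a clean set to be
   chains (p, Q_i) with a common prefix p, so that it is contained in X_s for
   s = (p, meet of the Q_i, join of the Q_i); and X_s <= X_t implies s = t.
   The maximal clean sets are therefore exactly the sets X_s. *)

Require Import Defs.
From mathcomp Require Import all_boot.

Set Implicit Arguments.
Unset Strict Implicit.
Unset Printing Implicit Defensive.

(** * Intersections of maximal cliques *)

Section Intersections.
Variables (T : finType) (e : rel T).

(** The closure operator of the Galois connection between vertex sets and sets of maximal cliques.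
    On a set contained in no maximal clique its value is the whole of [T]. *)
Definition hull (A : {set T}) : {set T} := \bigcap_(C in Kof e A) val C.

Lemma sub_hull (A : {set T}) : A \subset hull A.
Proof. by apply/bigcapsP=> C; rewrite inE. Qed.

Lemma hull_sub (A : {set T}) (C : mclique e) :
  A \subset val C -> hull A \subset val C.
Proof. by move=> AC; apply: bigcap_inf; rewrite inE. Qed.

Lemma Kof_sub (A B : {set T}) : A \subset B -> Kof e B \subset Kof e A.
Proof.
by move=> AB; apply/subsetP=> C; rewrite !inE; apply: subset_trans AB.
Qed.

Lemma hull_mono (A B : {set T}) : A \subset B -> hull A \subset hull B.
Proof.
move=> AB; apply/bigcapsP=> C; rewrite inE => BC.
exact: hull_sub (subset_trans AB BC).
Qed.

Lemma Kof_hull A : Kof e (hull A) = Kof e A.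
Proof.
apply/eqP; rewrite eqEsubset Kof_sub ?sub_hull //=.
by apply/subsetP=> C; rewrite !inE; apply: hull_sub.
Qed.

(** Intersections of maximal cliques are closed, and a family [P] with intersection [O] consists of
    members of [Kof e O]. Conversely, [Kof e O] itself serves as [P]. *)
Lemma mem_Ocal O :
  (O \in Ocal e) = [&& 2 <= #|O|, 2 <= #|Kof e O| & hull O \subset O].
Proof.
apply/idP/idP.
  rewrite !inE => /and3P[_ -> /existsP[P /and3P[sP cP /eqP defO]]] /=.
  have PK C (CP : C \in P) : {D : mclique e | val D = C & D \in Kof e O}.
    exists (Sub C (subsetP sP _ CP)) => //.
    by rewrite inE /= defO bigcap_inf.
  apply/andP; split; last first.
    rewrite {2}defO; apply/bigcapsP=> C /PK[D <-].
    by rewrite inE; apply: hull_sub.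
  apply: leq_trans cP _; rewrite -(card_imset (mem (Kof e O)) val_inj).
  by apply/subset_leq_card/subsetP=> C /PK[D <- DK]; apply: imset_f.
case/and3P=> cO cK sO.
have defO : O = \bigcap_(C in val @: Kof e O) C.
  rewrite big_imset /=; last by move=> ? ? _ _; apply: val_inj.
  by apply/eqP; rewrite eqEsubset sub_hull.
have sK : val @: Kof e O \subset max_cliques e.
  by apply/subsetP=> _ /imsetP[C _ ->]; apply: (valP C).
rewrite !inE cO /=; apply/andP; split.
  by apply/existsP; exists (val @: Kof e O); rewrite sK -defO eqxx.
apply/existsP; exists (val @: Kof e O).
by rewrite sK -defO eqxx card_imset ?cK //; apply: val_inj.
Qed.

Lemma sub_Ocal O (A : {set T}) : O \in Ocal e ->
  (forall C : mclique e, O \subset val C -> A \subset val C) -> A \subset O.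
Proof.
rewrite mem_Ocal => /and3P[_ _ hO] AC; apply: subset_trans hO.
by apply/bigcapsP=> C; rewrite inE; apply: AC.
Qed.

(** The cliques above [S0] are also above the intersection, and closedness is inherited because
    [hull] is monotone. *)
Lemma Ocal_bigcap (F : {set {set T}}) S0 :
  S0 \in F -> {subset F <= Ocal e} -> 2 <= #|\bigcap_(S in F) S| ->
  \bigcap_(S in F) S \in Ocal e.
Proof.
move=> S0F FO c2; rewrite mem_Ocal c2 /=; apply/andP; split.
  have := FO _ S0F; rewrite mem_Ocal => /and3P[_ cK _].
  by apply: leq_trans cK (subset_leq_card (Kof_sub _)); apply: bigcap_inf.
apply/bigcapsP=> S SF; have := FO _ SF; rewrite mem_Ocal => /and3P[_ _].
by apply: subset_trans; apply/hull_mono/bigcap_inf.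
Qed.

Lemma hull_Ocal (A : {set T}) :
  2 <= #|A| -> 2 <= #|Kof e A| -> hull A \in Ocal e.
Proof.
move=> cA cK; rewrite mem_Ocal Kof_hull cK.
rewrite (leq_trans cA (subset_leq_card (sub_hull A))) /=.
by apply/bigcapsP=> C; rewrite inE => AC; do 2!apply: hull_sub.
Qed.

End Intersections.

(** * The graph on vertices, maximal cliques and chains *)

Section Model.
Variables (T : finType) (e : rel T).

Definition chain (s : seq {set T}) : bool :=
  all [in Ocal e] s && sorted (fun A B : {set T} => A \proper B) s.

Lemma chain_rcons2 p Q R :
  chain (rcons (rcons p Q) R) =
  [&& chain (rcons p Q), R \in Ocal e & Q \proper R].
Proof.
rewrite /chain all_rcons; case: p => [|P p] /=.
  by rewrite !andbT andbA andbAC andbC andbA; do !case: (_ \in _).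
rewrite rcons_path last_rcons.
by case: (R \in _); case: (Q \proper R); rewrite ?andbT ?andbF.
Qed.

Lemma chain1 Q : chain [:: Q] = (Q \in Ocal e).
Proof. by rewrite /chain /= !andbT. Qed.

Lemma chain_take n s : chain s -> chain (take n s).
Proof.
rewrite /chain -{1 2}[s](cat_take_drop n) all_cat => /andP[/andP[-> _]] /=.
by case: (take n s) => //= A t; rewrite cat_path => /andP[].
Qed.

Lemma chain_nth s i : chain s -> i < size s -> nth set0 s i \in Ocal e.
Proof. by case/andP=> /(all_nthP set0) sO _; apply: sO. Qed.

Lemma chain_rcons_last p Q : chain (rcons p Q) -> Q \in Ocal e.
Proof. by rewrite /chain all_rcons -andbA => /and3P[]. Qed.

(* A chain of length j codes a vertex of level j + 1. *)
Definition code : Type := (B_vert e + seq {set T})%type.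

Definition clevel (c : code) : nat :=
  match c with inl u => B_level u | inr s => (size s).+1 end.

Definition valid (c : code) : bool :=
  match c with inl _ => true | inr s => (s != [::]) && chain s end.

(** Here [c] is the vertex of smaller level. Entries are indexed from 0, so the bounds on the last
    entry of a chain [t] of length j are the entries O_j and O_(j+1) of [s]. *)
Definition lower (c d : code) : bool :=
  match c, d with
  | inl (inl v), inl (inr C) => v \in val C
  | inl (inl v), inr s => v \in nth set0 s 0
  | inl (inr C), inr s => last set0 s \subset val C
  | inr t, inr s =>
      [&& size t < size s, take (size t).-1 s == take (size t).-1 t,
          nth set0 s (size t).-1 \subset last set0 t
        & last set0 t \subset nth set0 s (size t)]
  | _, _ => false
  end.

Definition cadj (c d : code) : bool := lower c d || lower d c.

(** Validity excludes the empty chain, which would share its level with the cliques. *)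
Lemma lower_level c d : valid d -> lower c d -> clevel c < clevel d.
Proof.
case: c d => [[v|C]|t] [[w|D]|s] //=.
  by case: s.
by move=> _ /and4P[].
Qed.

Lemma lower_rcons q S s :
  lower (inr (rcons q S)) (inr s) =
  [&& (size q).+1 < size s, take (size q) s == q,
      nth set0 s (size q) \subset S & S \subset nth set0 s (size q).+1].
Proof. by rewrite /= size_rcons last_rcons /= -cats1 take_size_cat. Qed.

(** Reading just past the end of [p] returns the default value; with the last entry [U] as default,
    it is treated uniformly with the entries of [p]. *)
Lemma nth_rcons_last (A : Type) (x0 : A) (p : seq A) U i :
  i <= size p -> nth x0 (rcons p U) i = nth U p i.
Proof.
rewrite nth_rcons leq_eqVlt => /predU1P[->|ip].
  by rewrite ltnn eqxx nth_default.
by rewrite ip; apply: set_nth_default.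
Qed.

Lemma take_rcons_le (A : Type) (p : seq A) U i :
  i <= size p -> take i (rcons p U) = take i p.
Proof. by move=> ip; rewrite -cats1 takel_cat. Qed.

Lemma lower_rcons2 q S p U :
  lower (inr (rcons q S)) (inr (rcons p U)) =
  [&& size q < size p, take (size q) p == q,
      nth set0 p (size q) \subset S & S \subset nth U p (size q).+1].
Proof.
rewrite lower_rcons size_rcons ltnS.
case: ltnP => //= qp; rewrite take_rcons_le ?nth_rcons_last ?(ltnW qp) //.
by rewrite (set_nth_default set0).
Qed.

Lemma lower_vertex_rcons v p U :
  lower (inl (inl v)) (inr (rcons p U)) = (v \in nth U p 0).
Proof. by rewrite /= nth_rcons_last. Qed.

Lemma lower_clique_rcons C p U :
  lower (inl (inr C)) (inr (rcons p U)) = (U \subset val C).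
Proof. by rewrite /= last_rcons. Qed.

Lemma lower_top q S p Q R : size q = size p ->
  lower (inr (rcons q S)) (inr (rcons (rcons p Q) R)) =
  [&& p == q, Q \subset S & S \subset R].
Proof.
move=> qp; rewrite lower_rcons2 qp size_rcons ltnSn.
rewrite take_rcons_le // take_size nth_rcons ltnn eqxx.
by rewrite nth_default ?size_rcons.
Qed.

(** [Q] stands for the meet and [R] for the join of [F]. The last entry of a chain bounds its
    neighbouring vertices and shorter chains from above only, and its neighbouring cliques from
    below only, so these bounds pass to [Q] and [R] respectively. *)
Lemma lower_family (F : {set {set T}}) S0 p (Q R : {set T}) (c : code) :
  S0 \in F ->
  (forall A : {set T},
     {in F, forall S : {set T}, A \subset S} -> A \subset Q) ->
  (forall C : mclique e,
     {in F, forall S : {set T}, S \subset val C} -> R \subset val C) ->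
  {in F, forall S : {set T}, lower c (inr (rcons p S))} -> valid c ->
  lower c (inr (rcons (rcons p Q) R)).
Proof.
move=> S0F FQ FR; case: c => [[v|C]|t].
- move=> vF _; rewrite lower_vertex_rcons; case: p vF => [|P p] vF /=.
    rewrite -sub1set; apply: FQ => S SF; rewrite sub1set.
    by have := vF _ SF.
  by have := vF _ S0F.
- move=> CF _; rewrite lower_clique_rcons; apply: FR => S SF.
  by have := CF _ SF; rewrite lower_clique_rcons.
case/lastP: t => [//|q S] qF _.
have := qF _ S0F; rewrite !lower_rcons2 => /and4P[qp /eqP tq nS _].
rewrite size_rcons ltnW // nth_rcons qp nS take_rcons_le ?(ltnW qp) //.
rewrite tq eqxx /= nth_rcons_last //.
(* If [q] is one shorter than [p], the upper bound is the last entry of each chain of the family,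
   and together these give [Q]; otherwise it is an entry of [p]. *)
case: (leqP (size p) (size q).+1) => [pq|qp'].
  rewrite nth_default //; apply: FQ => U UF.
  by have := qF _ UF; rewrite lower_rcons2 (nth_default _ pq) => /and4P[].
have := qF _ S0F; rewrite lower_rcons2 => /and4P[_ _ _].
by rewrite (set_nth_default Q).
Qed.

(** A converse of [lower_family] for the interval from [Q] to [R]. The level bound keeps out the
    chains as long as [rcons p S], which cannot be below it. *)
Lemma lower_between p (Q S R : {set T}) (c : code) :
  Q \subset S -> S \subset R -> valid c -> clevel c <= (size p).+1 ->
  lower c (inr (rcons (rcons p Q) R)) -> lower c (inr (rcons p S)).
Proof.
move=> QS SR; case: c => [[v|C]|t].
- rewrite !lower_vertex_rcons => _ _; case: p => //=.
  exact: (subsetP QS).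
- by rewrite !lower_clique_rcons => _ _; apply: subset_trans.
case/lastP: t => [//|q U] _; rewrite [clevel _]/= size_rcons ltnS => qp.
rewrite !lower_rcons2 size_rcons => /and4P[_].
rewrite qp take_rcons_le ?(ltnW qp) // => -> /=.
rewrite nth_rcons qp => -> /=; rewrite nth_rcons_last //.
case: (leqP (size p) (size q).+1) => [pq|qp'].
  by rewrite !nth_default // => UQ; apply: subset_trans QS.
by rewrite (set_nth_default S).
Qed.


(* N_(lo j) of a long enough chain depends on its first j entries: N_0 = O_1
   stands in for N_1, which depends on the last entry only. *)
Definition lo (j : nat) : nat := if j == 1 then 0 else j.

Lemma lower_lo p U U' (c : code) :
  p != [::] -> valid c -> clevel c = lo (size p) ->
  lower c (inr (rcons p U)) = lower c (inr (rcons p U')).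
Proof.
rewrite /lo; case: c => [[v|C]|t] p0.
- by move=> _ _; rewrite !lower_vertex_rcons; case: p p0.
(* [lo] never takes the value 1, so no clique has this level. *)
- by move=> _ /=; case: eqP => // + e1; rewrite -e1.
case/lastP: t => // q S _; rewrite [clevel _]/= size_rcons.
case: eqP => // _ qp; have lt_q : (size q).+1 < size p by rewrite -qp.
by rewrite !lower_rcons2 (set_nth_default U' U lt_q).
Qed.

Lemma chain_rcons p Q : chain (rcons p Q) -> chain p.
Proof.
by move/(chain_take (size p)); rewrite take_rcons_le // take_size.
Qed.

Lemma chain_rcons_subset p Q S :
  chain (rcons p Q) -> S \in Ocal e -> Q \subset S -> chain (rcons p S).
Proof.
case/lastP: p => [|p B]; first by rewrite !chain1.
rewrite !chain_rcons2 => /and3P[-> _ BQ] -> QS.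
exact: proper_sub_trans QS.
Qed.

Lemma valid_rcons p S : valid (inr (rcons p S)) = chain (rcons p S).
Proof. by case: p. Qed.


(** * Recovering a chain from its lower neighbours *)

Lemma chain_rcons2_drop q A B :
  chain (rcons (rcons q A) B) -> chain (rcons q B).
Proof.
move=> ch; apply: chain_rcons_subset (chain_rcons_last ch) _.
  exact: chain_rcons ch.
by move: ch; rewrite chain_rcons2 => /and3P[_ _ /proper_sub].
Qed.

(** On this level the neighbours of the first chain are the chains [rcons q S] with [S] between [A]
    and [B]; testing the ends [S = A] and [S = B] suffices. *)
Lemma sub_lower_rcons3 q A B U q' A' B' U' :
  chain (rcons (rcons q A) B) -> size q = size q' ->
  (forall c, valid c -> clevel c = (size q).+2 ->
     lower c (inr (rcons (rcons (rcons q A) B) U)) ->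
     lower c (inr (rcons (rcons (rcons q' A') B') U'))) ->
  [/\ q = q', A' \subset A & B \subset B'].
Proof.
move=> ch qq low; have AB : A \subset B.
  by move: ch; rewrite chain_rcons2 => /and3P[_ _ /proper_sub].
have lowE S q1 A1 B1 U1 : size q = size q1 ->
    lower (inr (rcons q S)) (inr (rcons (rcons (rcons q1 A1) B1) U1)) =
    [&& q == q1, A1 \subset S & S \subset B1].
  move=> qq1; rewrite lower_rcons2 !size_rcons -qq1 leqnSn.
  rewrite take_rcons_le ?size_rcons -?qq1 // take_rcons_le -?qq1 //.
  rewrite qq1 take_size eq_sym /= nth_rcons size_rcons ltnSn.
  by rewrite nth_rcons ltnn eqxx nth_rcons size_rcons ltnn eqxx.
have lowS S : chain (rcons q S) -> A \subset S -> S \subset B ->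
    [&& q == q', A' \subset S & S \subset B'].
  move=> chS AS SB; rewrite -(lowE _ _ _ _ U') //; apply: low.
  - by rewrite valid_rcons.
  - by rewrite /= size_rcons.
  - by rewrite lowE // eqxx AS.
have /and3P[/eqP -> -> _] := lowS A (chain_rcons ch) (subxx A) AB.
by have /and3P[] := lowS B (chain_rcons2_drop ch) AB (subxx B).
Qed.

(** A converse of [lower_lo], which turns the condition [same_nbh_lvl] into a common prefix. Level
    [lo (size p)] shows the vertices of the only entry if [p] has length 1, and otherwise the
    interval between the last two entries, so that [sub_lower_rcons3] applies both ways. *)
Lemma lower_prefix_inj p U p' U' :
  chain p -> chain p' -> p != [::] -> size p = size p' ->
  (forall c, valid c -> clevel c = lo (size p) ->
     lower c (inr (rcons p U)) = lower c (inr (rcons p' U'))) ->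
  p = p'.
Proof.
case/lastP: p => // p B; case/lastP: p' => [|p' B']; first by rewrite size_rcons.
rewrite !size_rcons => chp chp' _ /succn_inj.
case/lastP: p => [|q A] in chp *.
  case: p' chp' => // _ _ low; congr [:: _]; apply/setP=> v.
  by have := low (inl (inl v)); rewrite !lower_vertex_rcons; apply.
case/lastP: p' => [|q' A'] in chp' *; first by rewrite size_rcons.
rewrite !size_rcons /lo => /succn_inj qq low.
have [|eqq sA sB] := @sub_lower_rcons3 q A B U q' A' B' U' chp qq.
  by move=> c vc lc; rewrite low.
have [|_ sA' sB'] := @sub_lower_rcons3 q' A' B' U' q A B U chp' (esym qq).
  by move=> c vc lc; rewrite low // qq.
by congr (rcons (rcons _ _) _) => //; apply/eqP; rewrite eqEsubset ?sA ?sA' ?sB ?sB'.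
Qed.

(** One inclusion of neighbourhoods suffices because different levels bound the entries in opposite
    directions. Cliques put [R'] inside [R]; chains one entry shorter put [R] inside [R'] and [Q']
    inside [Q]; chains two entries shorter, or vertices, put [Q] inside [Q']. *)
Lemma sub_lower_eq s t :
  chain s -> chain t -> s != [::] -> size s = size t ->
  (forall c, valid c -> clevel c <= size s ->
     lower c (inr s) -> lower c (inr t)) ->
  s = t.
Proof.
case/lastP: s => // s R; case/lastP: t => [|t R']; first by rewrite size_rcons.
rewrite !size_rcons => chs cht _ /succn_inj eqsz low.
have RR' : R' \subset R.
  apply: sub_Ocal (chain_rcons_last chs) _ => D.
  have := low (inl (inr D)); rewrite !lower_clique_rcons; exact.
case/lastP: s => [|p Q] in chs eqsz low *.
  case: t eqsz cht low => // _ cht low; congr [:: _].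
  apply/eqP; rewrite eqEsubset RR' andbT; apply/subsetP=> v.
  by have := low (inl (inl v)); rewrite !lower_vertex_rcons; apply.
case/lastP: t => [|p' Q'] in cht eqsz low *; first by rewrite size_rcons in eqsz.
rewrite !size_rcons in eqsz low; move/succn_inj: eqsz => eqsz.
have QR : Q \subset R.
  by move: chs; rewrite chain_rcons2 => /and3P[_ _ /proper_sub].
have lowS S : chain (rcons p S) -> Q \subset S -> S \subset R ->
    [&& p' == p, Q' \subset S & S \subset R'].
  move=> chS QS SR; rewrite -lower_top //; apply: low.
  - by rewrite valid_rcons.
  - by rewrite /= size_rcons.
  - by rewrite lower_top // eqxx QS.
have /and3P[/eqP pp' Q'Q _] := lowS Q (chain_rcons chs) (subxx Q) QR.
have /and3P[_ _ RsubR'] := lowS R (chain_rcons2_drop chs) QR (subxx R).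
have -> : R = R' by apply/eqP; rewrite eqEsubset RsubR'.
rewrite {}pp' in cht low *; congr (rcons (rcons _ _) _).
apply/eqP; rewrite eqEsubset Q'Q andbT.
case/lastP: p => [|q A] in chs low cht {lowS eqsz} *.
  apply/subsetP=> v.
  by have := low (inl (inl v)); rewrite !lower_vertex_rcons; apply.
have [|//] := @sub_lower_rcons3 q A Q R q A Q' R' (chain_rcons chs) erefl.
by move=> c vc lc; apply: low; rewrite // lc size_rcons.
Qed.

(** Provides the two common neighbours that [mem_Vstar] demands on a level of the form [lo m.+1]:
    two vertices of [Q] if [p] is empty, and otherwise [p] itself and [p] with its last entry
    replaced by [Q]. *)
Lemma lower_lo_pair p Q R :
  chain (rcons (rcons p Q) R) ->
  exists c d : code,
    [/\ c != d, valid c && valid d, clevel c = lo (size p).+1,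
        clevel d = lo (size p).+1
      & lower c (inr (rcons (rcons p Q) R)) &&
        lower d (inr (rcons (rcons p Q) R))].
Proof.
case/lastP: p => [|p B] chs.
  have := chain_nth chs (i := 0); rewrite mem_Ocal => /(_ isT).
  case/and3P=> /card_gt1P[v [w [vs ws vw]]] _ _.
  by exists (inl (inl v)), (inl (inl w)); split; rewrite //= ?vs.
have chQ := chain_rcons chs.
have BQ : B \proper Q by move: chQ; rewrite chain_rcons2 => /and3P[].
exists (inr (rcons p B)), (inr (rcons p Q)).
rewrite !valid_rcons (chain_rcons chQ) (chain_rcons2_drop chQ).
rewrite /lo ![clevel _]/= !size_rcons; split=> //.
  by apply: contraTneq BQ => -[/rcons_inj[->]]; rewrite properxx.
rewrite !lower_rcons2 !size_rcons leqnSn.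
rewrite !take_rcons_le ?size_rcons // take_size eqxx /=.
rewrite !nth_rcons !size_rcons ltnSn ltnn !eqxx ltnn.
by rewrite !subxx (proper_sub BQ).
Qed.

End Model.

(** * Maximal clean sets *)

(** The witness in [Vplus] is recovered as the top part of [X], since a common neighbour of top
    vertices cannot lie in the top level. *)
Lemma VplusP k (G : kpartite k) (X : {set G}) :
  let A := X :&: lvl G k.-1 in
  reflect [/\ 2 <= #|A|, 2 <= #|\bigcap_(x in A) nbh x|
            & X = A :|: \bigcap_(x in A) nbh x]
          (X \in Vplus G).
Proof.
move=> A; rewrite inE; apply: (iffP existsP) => [[B]|[cA cN defX]]; last first.
  by exists A; rewrite subsetIr cA cN -defX eqxx.
case/and4P=> sB cB cN /eqP defX.
suff defA : A = B by rewrite defA.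
have /card_gt1P[b [_ [bB _ _]]] := cB.
apply/setP=> y; rewrite /A defX !inE; apply/andP/idP=> [[]|yB]; last first.
  by rewrite yB; have := subsetP sB _ yB; rewrite inE.
case/orP=> // /bigcapP/(_ b bB); rewrite inE => /kadj_level.
have := subsetP sB _ bB; rewrite inE => /eqP bk + /eqP yk.
by rewrite -val_eqE /= bk yk eqxx.
Qed.

(* The three cases of the definition for at least three levels, in one form. *)
Lemma mem_Vstar m (G : kpartite m.+3) (X : {set G}) :
  (X \in Vstar G) =
  [&& X \in Vplus G, 2 <= #|common_nbh_lvl 1 X|,
      2 <= #|common_nbh_lvl (lo m.+1) X| & (m == 0) || same_nbh_lvl (lo m) X].
Proof.
rewrite /Vstar; case: m G X => [|[|m]] G X; rewrite /= !inE ?andbT //=.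
  by congr (_ && _); rewrite andbCA.
by congr (_ && _); rewrite !subSS subn0 andbA andbC.
Qed.

(** * Stages isomorphic to the graph on codes *)

Section Labels.
Variables (T : finType) (e : rel T).

(** An isomorphism of the stage onto the graph of valid codes of level at most [n.+1]; the n + 2
    levels are numbered from 0. *)
Record labelled n (H : stage e n.+2) (lab : H -> code e) : Prop := Labelled {
  lab_inj : injective lab;
  lab_valid : forall x, valid (lab x);
  lab_level : forall x, klevel x = clevel (lab x) :> nat;
  lab_surj : forall c, valid c -> clevel c <= n.+1 -> exists x, lab x = c;
  lab_adj : forall x y, kadj x y = cadj (lab x) (lab y);
  lab_base : forall u, lab (stage_base H u) = inl u
}.

(** For a chain [s] of length [n.+1], this set becomes the new vertex coded by [s]. *)
Definition below n (H : stage e n.+2) (lab : H -> code e) s : {set H} :=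
  [set x | lower (lab x) (inr s)].

Section LabelledStage.
Variables (n : nat) (H : stage e n.+2) (lab : H -> code e).
Hypothesis labH : labelled lab.

Lemma mem_lvl x i : (x \in lvl H i) = (clevel (lab x) == i).
Proof. by rewrite inE (lab_level labH). Qed.

Lemma mem_nbh_top x y :
  x \in lvl H n.+1 -> (y \in nbh x) = lower (lab y) (lab x).
Proof.
rewrite mem_lvl inE (lab_adj labH) /cadj => /eqP xn.
case: (boolP (lower (lab x) _)) => //= /(lower_level (lab_valid labH y)).
by rewrite xn -(lab_level labH) ltnNge -ltnS ltn_ord.
Qed.

Lemma card_gt1_codes (B : {set H}) c d :
  c != d -> valid c -> valid d -> clevel c <= n.+1 -> clevel d <= n.+1 ->
  (forall x, lab x = c \/ lab x = d -> x \in B) -> 2 <= #|B|.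
Proof.
move=> cd vc vd lc ld cdB.
have [[x xc] [y yd]] := (lab_surj labH vc lc, lab_surj labH vd ld).
apply/card_gt1P; exists x, y; split; first by apply: cdB; left.
  by apply: cdB; right.
by apply: contraNneq cd => xy; rewrite -xc xy yd.
Qed.

(** [s] has level [n.+2], one above the stage, so every valid code of smaller level is a label and
    [sub_lower_eq] applies. *)
Lemma sub_below_eq s t :
  chain e s -> chain e t -> size s = n.+1 -> size t = n.+1 ->
  below lab s \subset below lab t -> s = t.
Proof.
move=> chs cht ss st sub; apply: sub_lower_eq chs cht _ _ _.
- by rewrite -size_eq0 ss.
- by rewrite ss.
move=> c vc; rewrite ss => lc; have [x <-] := lab_surj labH vc lc.
by have := subsetP sub x; rewrite !inE.
Qed.

End LabelledStage.

(** If [X] had no top element, the intersection on the left would be the whole vertex set, not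
    confined to level [i]. *)
Lemma mem_common_nbh_lvl m (H : stage e m.+2) i (X : {set H}) y :
  X :&: lvl H m.+1 != set0 ->
  (y \in common_nbh_lvl i X) =
  (y \in \bigcap_(x in X :&: lvl H m.+1) nbh x) && (y \in lvl H i).
Proof.
case/set0Pn=> x0 x0X; apply/bigcapP/andP=> [yX|[/bigcapP yX yi] x xX]; last first.
  by rewrite inE yX.
split; last by have := yX _ x0X; rewrite inE => /andP[].
by apply/bigcapP=> x xX; have := yX _ xX; rewrite inE => /andP[].
Qed.


(** * The lower neighbours of a chain form a clean set *)

Section BelowIsClean.
Variables (n : nat) (H : stage e n.+2) (lab : H -> code e).
Hypothesis labH : labelled lab.

Lemma below_Vplus s :
  chain e s -> s != [::] -> 2 <= #|below lab s :&: lvl H n.+1| ->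
  \bigcap_(x in below lab s :&: lvl H n.+1) nbh x = below lab s :\: lvl H n.+1 ->
  below lab s \in Vplus H.
Proof.
move=> chs s0 cA defN; apply/VplusP; rewrite [_.-1]/= defN setID; split=> //.
(* The first entry of [s] contains two vertices, and these are the two common neighbours
   required. *)
have := chain_nth chs (i := 0); rewrite lt0n size_eq0 mem_Ocal => /(_ s0).
case/and3P=> /card_gt1P[v [w [vs ws vw]]] _ _.
apply: (@card_gt1_codes _ _ _ labH _ (inl (inl v)) (inl (inl w))) => //.
by move=> x labx; rewrite inE (mem_lvl labH) inE; case: labx => ->.
Qed.

End BelowIsClean.

Lemma below_Vstar1 (H : stage e 2) (lab : H -> code e) O :
  labelled lab -> O \in Ocal e -> below lab [:: O] \in Vstar H.
Proof.
move=> labH OO; suff : below lab [:: O] \in Vplus H by [].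
apply: (below_Vplus labH); rewrite ?chain1 //.
  have := OO; rewrite mem_Ocal => /and3P[_ /card_gt1P[C [D [CO DO CD]]] _].
  apply: (@card_gt1_codes _ _ _ labH _ (inl (inr C)) (inl (inr D))) => //.
  move=> x labx; rewrite inE (mem_lvl labH) inE.
  by rewrite !inE in CO DO; case: labx => ->; rewrite /= ?CO ?DO.
apply/setP=> y; rewrite in_setD (mem_lvl labH) [in RHS]inE.
have topE x : x \in lvl H 1 -> (y \in nbh x) = lower (lab y) (lab x).
  exact: mem_nbh_top.
apply/bigcapP/andP=> [yN|[yl yO] x].
  have ex (C : mclique e) : O \subset val C -> lower (lab y) (inl (inr C)).
    move=> OC; have [x xC] := lab_surj labH (c := inl (inr C)) isT isT.
    rewrite -xC -topE; last by rewrite (mem_lvl labH) xC.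
    by apply: yN; rewrite inE (mem_lvl labH) xC /= inE xC /= OC.
  (* Some clique lies above [O], so its neighbour [y] is a vertex; being in all such cliques, this
     vertex is in the closed set [O]. *)
  have := OO; rewrite mem_Ocal => /and3P[_ /card_gt1P[C [_ [+ _ _]]] _].
  rewrite inE => /ex; case: (lab y) ex => [[v|D]|s] //= vC _.
  split=> //; rewrite -sub1set; apply: sub_Ocal OO _ => D OD.
  by rewrite sub1set; apply: vC.
rewrite inE => /andP[xO x1]; rewrite topE //.
move: xO x1 yO yl; rewrite inE (mem_lvl labH).
case: (lab x) (lab_valid labH x) => [[w|C]|s] //=; last by case: s.
case: (lab y) (lab_valid labH y) => [[v|D]|s] //=; last by case: s.
by move=> _ _ /subsetP OC _ /OC.
Qed.

Section BelowIsCleanS.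
Variables (m : nat) (H : stage e m.+3) (lab : H -> code e).
Hypothesis labH : labelled lab.
Variables (p : seq {set T}) (Q R : {set T}).
Hypotheses (szp : size p = m) (chs : chain e (rcons (rcons p Q) R)).
Let s := rcons (rcons p Q) R.

Let QR : Q \subset R.
Proof. by move: chs; rewrite chain_rcons2 => /and3P[_ _ /proper_sub]. Qed.

Lemma below_top x : x \in below lab s :&: lvl H m.+2 ->
  exists S, [/\ lab x = inr (rcons p S), Q \subset S & S \subset R].
Proof.
rewrite inE (mem_lvl labH) inE /s => /andP[+ /eqP].
case: (lab x) (lab_valid labH x) => [[v|C]|t] //.
case/lastP: t => // q S _ + [/eqP]; rewrite size_rcons eqSS => + /eqP sq.
rewrite lower_top ?sq ?szp // => /and3P[/eqP -> QS SR].
by exists S.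
Qed.

Lemma below_topI x S : lab x = inr (rcons p S) ->
  Q \subset S -> S \subset R -> x \in below lab s :&: lvl H m.+2.
Proof.
move=> labx QS SR; rewrite inE (mem_lvl labH) inE labx lower_top // eqxx QS SR.
by rewrite /= size_rcons szp.
Qed.

Lemma below_lab_ends : exists x y,
  [/\ lab x = inr (rcons p Q), lab y = inr (rcons p R),
      x \in below lab s :&: lvl H m.+2 & y \in below lab s :&: lvl H m.+2].
Proof.
have [x labx] : exists x, lab x = inr (rcons p Q).
  apply: (lab_surj labH); first by rewrite valid_rcons (chain_rcons chs).
  by rewrite /= size_rcons szp.
have [y laby] : exists x, lab x = inr (rcons p R).
  apply: (lab_surj labH); first by rewrite valid_rcons (chain_rcons2_drop chs).
  by rewrite /= size_rcons szp.
by exists x, y; split; [| |apply: below_topI labx _ _|apply: below_topI laby _ _].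
Qed.

(** The extreme top elements, ending in [Q] and in [R], already cut out the common neighbours, by
    [lower_family] for the pair [Q], [R]. The other inclusion is [lower_between]. *)
Lemma below_nbh :
  \bigcap_(x in below lab s :&: lvl H m.+2) nbh x = below lab s :\: lvl H m.+2.
Proof.
apply/setP=> y; rewrite in_setD; apply/bigcapP/andP=> [yN|[yl ys] x xA].
  have [a [b [laba labb aA bA]]] := below_lab_ends.
  have ya := yN _ aA; have yb := yN _ bA.
  move: aA bA; rewrite !in_setI => /andP[_ atop] /andP[_ btop].
  rewrite (mem_nbh_top labH) // laba in ya; rewrite (mem_nbh_top labH) // labb in yb.
  split.
    rewrite (mem_lvl labH) neq_ltn.
    have := lower_level _ ya; rewrite valid_rcons (chain_rcons chs) => /(_ isT).
    by rewrite /= size_rcons szp => ->.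
  rewrite inE; apply: (lower_family (F := [set Q; R]) (S0 := Q)).
  - exact: set21.
  - by move=> A; apply; apply: set21.
  - by move=> C; apply; apply: set22.
  - by move=> S /set2P[] ->.
  - exact: lab_valid.
have [S [labx QS SR]] := below_top xA.
move: xA; rewrite in_setI => /andP[_ xtop].
rewrite (mem_nbh_top labH) // labx; rewrite inE in ys.
apply: lower_between QS SR _ _ ys; first exact: lab_valid.
(* Outside the top level, [y] has level at most [m.+1], as [lower_between] demands. *)
rewrite szp -ltnS ltn_neqAle -(mem_lvl labH) yl -(lab_level labH) -ltnS.
exact: ltn_ord.
Qed.

Lemma below_common i (c d : code e) :
  c != d -> valid c -> valid d -> clevel c = i -> clevel d = i ->
  i <= m.+1 -> lower c (inr s) -> lower d (inr s) ->
  2 <= #|common_nbh_lvl i (below lab s)|.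
Proof.
move=> cd vc vd ci di im cs ds.
apply: (card_gt1_codes labH cd vc vd); rewrite ?ci ?di ?(leqW im) //.
move=> x labx; rewrite mem_common_nbh_lvl; last first.
  by have [a [_ [_ _ aA _]]] := below_lab_ends; apply/set0Pn; exists a.
rewrite below_nbh in_setD !(mem_lvl labH) inE.
by case: labx => ->; rewrite ?ci ?di eqxx ?cs ?ds neq_ltn ltnS im.
Qed.

Lemma below_VstarS : below lab s \in Vstar H.
Proof.
have [QR' OR] : Q \proper R /\ R \in Ocal e.
  by move: chs; rewrite chain_rcons2 => /and3P[].
rewrite mem_Vstar; apply/and4P; split.
- apply: (below_Vplus labH) => //; first by rewrite -size_eq0 size_rcons.
    have [a [b [laba labb aA bA]]] := below_lab_ends.
    apply/card_gt1P; exists a, b; split=> //.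
    apply: contraTneq QR' => ab; move: labb; rewrite -ab laba.
    by move=> -[/rcons_inj[->]]; rewrite properxx.
  exact: below_nbh.
- move: OR; rewrite mem_Ocal => /and3P[_ /card_gt1P[C [D [CR DR CD]]] _].
  rewrite !inE in CR DR.
  apply: (@below_common _ (inl (inr C)) (inl (inr D))) => //; rewrite ?lower_clique_rcons //.
- have [c [d [cd /andP[vc vd] lc ld /andP[cs ds]]]] := lower_lo_pair chs.
  rewrite szp in lc ld; apply: (below_common cd vc vd lc ld) => //.
  by rewrite /lo; case: ifP.
(* The last condition is void for three levels. Otherwise all top elements share the prefix [p] of
   length [m], and [lower_lo] applies. *)
case: (eqVneq m 0) => //= m0.
apply/forall_inP=> x xA; apply/forall_inP=> y yA.
have [S [labx _ _]] := below_top xA; have [S' [laby _ _]] := below_top yA.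
move: xA yA; rewrite !in_setI => /andP[_ xtop] /andP[_ ytop].
apply/eqP/setP=> z; rewrite !in_setI !(mem_nbh_top labH) // labx laby.
rewrite (mem_lvl labH); case: eqP; rewrite ?andbF // => zl.
congr (_ && _); apply: lower_lo; rewrite ?szp //; last exact: lab_valid.
by rewrite -size_eq0 szp.
Qed.
End BelowIsCleanS.


(** * Every clean set lies below some chain *)

Lemma card_gt1_vertices n (H : stage e n.+2) lab (B : {set H}) (O : {set T}) :
  labelled lab -> 2 <= #|B| ->
  {in B, forall y, exists2 v, lab y = inl (inl v) & v \in O} -> 2 <= #|O|.
Proof.
move=> labH /card_gt1P[y [z [yB zB yz]]] BO.
have [v yv vO] := BO _ yB; have [w zw wO] := BO _ zB.
apply/card_gt1P; exists v, w; split=> //.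
by apply: contraNneq yz => vw; apply/eqP/(lab_inj labH); rewrite yv zw vw.
Qed.

Lemma card_gt1_cliques n (H : stage e n.+2) lab (B : {set H})
    (K : {set mclique e}) :
  labelled lab -> 2 <= #|B| ->
  {in B, forall y, exists2 C, lab y = inl (inr C) & C \in K} -> 2 <= #|K|.
Proof.
move=> labH /card_gt1P[y [z [yB zB yz]]] BO.
have [v yv vO] := BO _ yB; have [w zw wO] := BO _ zB.
apply/card_gt1P; exists v, w; split=> //.
by apply: contraNneq yz => vw; apply/eqP/(lab_inj labH); rewrite yv zw vw.
Qed.

(** [O] is the intersection of the cliques in [X]: two top elements give two cliques above it, and
    two common neighbours give two vertices in it. *)
Lemma Vstar_sub_below1 (H : stage e 2) (lab : H -> code e) X :
  labelled lab -> X \in Vstar H ->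
  exists2 O, O \in Ocal e & X \subset below lab [:: O].
Proof.
move=> labH; have -> : Vstar H = Vplus H by [].
case/VplusP; rewrite [2.-1]/=; set A := _ :&: _ => cA cN defX.
pose F := [set C : mclique e | [exists x in A, lab x == inl (inr C)]].
pose O := \bigcap_(C in F) val C.
have AF x : x \in A -> exists2 C, lab x = inl (inr C) & C \in F.
  move=> xA; have := xA; rewrite inE (mem_lvl labH) => /andP[_].
  case labx: (lab x) (lab_valid labH x) => [[v|C]|s] //=; last by case: s labx.
  by exists C => //; rewrite inE; apply/exists_inP; exists x => //; apply/eqP.
have AO x C : x \in A -> lab x = inl (inr C) -> O \subset val C.
  move=> xA labx; apply: bigcap_inf; rewrite inE.
  by apply/exists_inP; exists x => //; apply/eqP.
have [x0 [_ [x0A _ _]]] := card_gt1P cA.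
have NO y : y \in \bigcap_(x in A) nbh x ->
    exists2 v, lab y = inl (inl v) & v \in O.
  move/bigcapP=> yN.
  have yC C : C \in F -> lower (lab y) (inl (inr C)).
    rewrite inE => /exists_inP[x xA /eqP <-].
    rewrite -(mem_nbh_top labH) ?yN //.
    by move: xA; rewrite inE => /andP[].
  have [C _ /yC] := AF _ x0A; case laby: (lab y) yC => [[v|]|] // yC _.
  by exists v => //; apply/bigcapP.
have OO : O \in Ocal e.
  rewrite mem_Ocal (card_gt1_vertices labH cN) //=.
  rewrite (card_gt1_cliques labH cA) /= => [|x xA]; last first.
    by have [C labx _] := AF _ xA; exists C; rewrite // inE (AO x).
  by apply/bigcapsP=> C CF; apply/hull_sub/bigcap_inf.
exists O => //; apply/subsetP=> x; rewrite defX inE => /orP[xA|/NO[v]].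
  by have [C labx _] := AF _ xA; rewrite inE labx /= (AO x).
by rewrite inE => ->.
Qed.

Section Covering.
Variables (m : nat) (H : stage e m.+3) (lab : H -> code e).
Hypothesis labH : labelled lab.
Variable X : {set H}.
Hypothesis VX : X \in Vstar H.
Let A := X :&: lvl H m.+2.

Lemma top_code x : x \in lvl H m.+2 ->
  exists p S, [/\ lab x = inr (rcons p S), size p = m & chain e (rcons p S)].
Proof.
rewrite (mem_lvl labH).
case: (lab x) (lab_valid labH x) => [[v|C]|t] //.
case/lastP: t => // q S; rewrite valid_rcons => chS /eqP[].
by rewrite size_rcons => -[sq]; exists q, S.
Qed.

(** For [m = 0] the prefix is empty; otherwise equal neighbourhoods on level [lo m] determine it by
    [lower_prefix_inj]. *)
Lemma Vstar_prefix : exists2 p, size p = m &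
  {in A, forall x, exists2 S, lab x = inr (rcons p S) & chain e (rcons p S)}.
Proof.
move: VX; rewrite mem_Vstar => /and4P[/VplusP[+ _ _] _ _].
rewrite [_.-1]/= -/A => /card_gt1P[x0 [_ [x0A _ _]]] same.
have Atop x : x \in A -> x \in lvl H m.+2 by rewrite inE => /andP[].
have [p [S0 [labx0 sp chS0]]] := top_code (Atop _ x0A).
exists p => // x xA; have [p' [S [labx sp' chS]]] := top_code (Atop _ xA).
suff eqp : p = p' by exists S; rewrite // eqp.
have [m0|m0] := eqVneq m 0.
  by rewrite m0 in sp sp'; rewrite (size0nil sp) (size0nil sp').
rewrite (negPf m0) /= in same.
apply: (@lower_prefix_inj _ e p S0 p' S).
- exact: chain_rcons chS0.
- exact: chain_rcons chS.
- by rewrite -size_eq0 sp.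
- by rewrite sp.
rewrite sp => c vc lc; have lcm : clevel c <= m.+2.
  by rewrite lc /lo; case: ifP => // _; do 2!apply: leqW.
have [y laby] := lab_surj labH vc lcm.
have /forall_inP/(_ _ x0A)/forall_inP/(_ _ xA)/eqP/setP/(_ y) := same.
rewrite !in_setI !(mem_nbh_top labH) ?Atop // (mem_lvl labH) laby lc eqxx !andbT.
by rewrite labx0 labx.
Qed.

Lemma Vstar_sub_belowS :
  exists s, [/\ chain e s, size s = m.+2 & X \subset below lab s].
Proof.
have [p szp Ap] := Vstar_prefix.
pose F := [set S | [exists x in A, lab x == inr (rcons p S)]].
(* Meet and join of the last entries; a union of closed sets need not be closed, hence the hull. *)
pose Q := \bigcap_(S in F) S; pose R := hull e (\bigcup_(S in F) S).
have mem_F x S : x \in A -> lab x = inr (rcons p S) -> S \in F.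
  by move=> xA labx; rewrite inE; apply/exists_inP; exists x => //; apply/eqP.
have F_mem S : S \in F -> exists2 x, x \in A & lab x = inr (rcons p S).
  by rewrite inE => /exists_inP[x xA /eqP]; exists x.
have chF S : S \in F -> chain e (rcons p S).
  by case/F_mem=> x /Ap[S' -> ch] [/rcons_inj[<-]].
have FO : {subset F <= Ocal e} by move=> S /chF/chain_rcons_last.
have FQ S : S \in F -> Q \subset S by move=> SF; apply: bigcap_inf.
have FR S : S \in F -> S \subset R.
  by move=> SF; apply: subset_trans (sub_hull _ _); apply: bigcup_sup SF.
move: VX; rewrite mem_Vstar => /and4P[/VplusP[]].
rewrite [_.-1]/= -/A => cA cN defX c1 clo _.
have [x1 [x2 [x1A x2A x12]]] := card_gt1P cA.
have A0 : A != set0 by apply/set0Pn; exists x1.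
have lowN y S : y \in \bigcap_(x in A) nbh x -> S \in F ->
    lower (lab y) (inr (rcons p S)).
  move=> /bigcapP yN /F_mem[x xA <-]; rewrite -(mem_nbh_top labH) ?yN //.
  by move: xA; rewrite inE => /andP[].
have lowC i y : y \in common_nbh_lvl i X ->
    clevel (lab y) = i /\ {in F, forall S, lower (lab y) (inr (rcons p S))}.
  rewrite mem_common_nbh_lvl // (mem_lvl labH) => /andP[yN /eqP yi].
  by split=> // S; apply: lowN.
have [S1 labx1 chS1] := Ap _ x1A; have [S2 labx2 chS2] := Ap _ x2A.
have [S1F S2F] := (mem_F _ _ x1A labx1, mem_F _ _ x2A labx2).
(* Equality would make all members of [F] equal, whereas [x1] and [x2] have different labels. *)
have QR : Q \proper R.
  rewrite properE (subset_trans (FQ _ S1F)) ?FR //=.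
  apply: contra x12 => RQ; apply/eqP/(lab_inj labH); rewrite labx1 labx2.
  congr (inr (rcons _ _)); apply/eqP.
  rewrite eqEsubset (subset_trans (FR _ S1F)) ?(subset_trans RQ) ?FQ //.
  by rewrite (subset_trans (FR _ S2F)) ?(subset_trans RQ) ?FQ.
have OR : R \in Ocal e.
  apply: hull_Ocal.
    have := FO _ S1F; rewrite mem_Ocal => /andP[cS1 _].
    by apply: leq_trans cS1 (subset_leq_card _); apply: bigcup_sup S1F.
  (* The condition on level 1 yields two cliques that contain every member of [F]. *)
  apply: (card_gt1_cliques labH c1) => y /lowC[y1 ylow].
  case laby: (lab y) y1 (lab_valid labH y) ylow => [[v|C]|t] //; last by case: t laby.
  move=> _ _ ylow; exists C => //; rewrite inE; apply/bigcupsP=> S SF.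
  by have := ylow _ SF; rewrite lower_clique_rcons.
have chQ : chain e (rcons p Q).
  have [p0|[p0 [B defp]]] : p = [::] \/ exists p0 B, p = rcons p0 B.
    by case/lastP: (p) => [|p0 B]; [left | right; exists p0, B].
    (* With an empty prefix [lo m.+1] is 0, so the condition on that level yields two vertices of
       [Q]. *)
    rewrite p0 chain1; apply: Ocal_bigcap S1F FO _.
    apply: (card_gt1_vertices labH clo) => y /lowC[ylo ylow].
    have {ylo} : clevel (lab y) = 0 by rewrite ylo -szp p0.
    case laby: (lab y) ylow => [[v|]|] // ylow _; exists v => //.
    apply/bigcapP=> S SF.
    by have := ylow _ SF; rewrite lower_vertex_rcons p0.
  have lom : lo m.+1 = (size p0).+2 by rewrite -szp defp size_rcons.
  have chB : chain e (rcons p0 B) by rewrite -defp; apply: chain_rcons chS1.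
  have codeC y : y \in common_nbh_lvl (lo m.+1) X ->
      exists U, [/\ lab y = inr (rcons p0 U), B \subset U & U \subset Q].
    move=> /lowC[]; rewrite lom.
    case: (lab y) (lab_valid labH y) => [[v|C]|t] //.
    case/lastP: t => // q U _ [/eqP]; rewrite size_rcons eqSS => /eqP sq ylow.
    exists U; have := ylow _ S1F; rewrite lower_rcons2 defp sq => /and4P[_].
    rewrite take_rcons_le // take_size => /eqP <-.
    rewrite nth_rcons ltnn eqxx => BU _; split=> //; apply/bigcapsP=> S SF.
    have := ylow _ SF; rewrite lower_rcons2 defp sq => /and4P[_ _ _].
    by rewrite nth_default ?size_rcons.
  have /card_gt1P[y [z [/codeC[U [yU BU UQ]] /codeC[W [zW BW WQ]] yz]]] := clo.
  (* The two chains found on level [lo m.+1] end in distinct sets between [B] and [Q], so [B] and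
     [Q] differ. *)
  have BQ : B \proper Q.
    rewrite properE (subset_trans BU UQ) /=.
    apply: contra yz => QB; apply/eqP/(lab_inj labH); rewrite yU zW.
    congr (inr (rcons _ _)); apply/eqP.
    rewrite eqEsubset (subset_trans UQ) ?(subset_trans QB) //.
    by rewrite (subset_trans WQ) ?(subset_trans QB).
  rewrite defp chain_rcons2 chB BQ andbT; apply: Ocal_bigcap S1F FO _.
  have := chain_rcons_last chB; rewrite mem_Ocal => /andP[cB _].
  exact: leq_trans cB (subset_leq_card (proper_sub BQ)).
exists (rcons (rcons p Q) R); split.
- by rewrite chain_rcons2 chQ OR.
- by rewrite !size_rcons szp.
apply/subsetP=> x; rewrite defX in_setU => /orP[xA|xN]; rewrite inE.
  have [S labx _] := Ap _ xA; have SF := mem_F _ _ xA labx.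
  by rewrite labx lower_top // eqxx FQ ?FR.
apply: (lower_family (F := F) S1F).
- by move=> B BF; apply/bigcapsP.
- by move=> C CF; apply/hull_sub/bigcupsP.
- by move=> S; apply: lowN.
- exact: lab_valid.
Qed.
End Covering.


(** * The clean-factor series *)

Section NextStage.
Variables (n : nat) (H : stage e n.+2) (lab : H -> code e).
Hypothesis labH : labelled lab.

Lemma below_Vstar s :
  chain e s -> size s = n.+1 -> below lab s \in Vstar H.
Proof.
case: n H lab labH => [|m] H' lab' labH'.
  case: s => [|O [|]] // chO _; apply: below_Vstar1 => //.
  by rewrite -chain1.
case/lastP: s => // s R; case/lastP: s => // p Q chs.
by rewrite !size_rcons => -[szp]; apply: below_VstarS.
Qed.

Lemma Vstar_sub_below X : X \in Vstar H ->
  exists s, [/\ chain e s, size s = n.+1 & X \subset below lab s].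
Proof.
case: n H lab labH X => [|m] H' lab' labH' X VX; last exact: Vstar_sub_belowS.
have [O OO XO] := Vstar_sub_below1 labH' VX.
by exists [:: O]; rewrite chain1.
Qed.

(** A clean set containing [below lab s] lies in some [below lab t], and then [s = t] by
    [sub_below_eq]. *)
Lemma below_max s : chain e s -> size s = n.+1 ->
  below lab s \in max_elements (Vstar H).
Proof.
move=> chs szs; rewrite inE; apply/maxsetP; split; first exact: below_Vstar.
move=> Y /Vstar_sub_below[t [cht szt Yt]] sY; apply/eqP.
rewrite eqEsubset sY andbT.
by rewrite (sub_below_eq labH chs cht szs szt (subset_trans sY Yt)).
Qed.

Lemma max_below X : X \in max_elements (Vstar H) ->
  exists2 s : n.+1.-tuple {set T}, chain e s & below lab s = X.
Proof.
rewrite inE => /maxsetP[/Vstar_sub_below[s [chs szs Xs]] Xmax].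
have tup_s : size s == n.+1 by apply/eqP.
by exists (Tuple tup_s) => //; apply: Xmax => //; apply: below_Vstar.
Qed.

(** Tuples make [pick] search a finite type; the default value is never reached, by
    [next_label_new]. *)
Definition next_label (u : clean_factor H) : code e :=
  match u with
  | inl x => lab x
  | inr X => inr (odflt (nseq_tuple n.+1 set0)
      [pick s : n.+1.-tuple {set T} | chain e s && (below lab s == val X)]
      : seq {set T})
  end.

Lemma next_label_new (X : {X : {set H} | X \in max_elements (Vstar H)}) :
  exists s, [/\ next_label (inr X) = inr s, size s = n.+1, chain e s
              & below lab s = val X].
Proof.
rewrite /next_label; case: pickP => [s /andP[chs /eqP sX]|noS] /=.
  by exists s; rewrite size_tuple.
have [s chs sX] := max_below (valP X).
by have := noS s; rewrite chs sX eqxx.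
Qed.

(** New vertices get level [n.+2], which separates their labels from the old ones and leaves only
    one direction of [lower] possible between an old and a new vertex. *)
Lemma next_labelled :
  @labelled n.+1 (@Stage T e n.+3 (clean_factor H) (fun u =>
    inl (stage_base H u) : fact_vert (Vstar H))) next_label.
Proof.
split.
- move=> [x|X] [y|Y].
  + by move=> /(lab_inj labH) ->.
  + have [s [-> szs _ _]] := next_label_new Y => labx.
    have := ltn_ord (klevel x).
    by rewrite (lab_level labH) /= in labx *; rewrite labx /= szs ltnn.
  + have [s [-> szs _ _]] := next_label_new X => labx.
    have := ltn_ord (klevel y).
    by rewrite (lab_level labH) /= in labx *; rewrite -labx /= szs ltnn.
  + have [s [-> _ _ sX]] := next_label_new X.
    have [t [-> _ _ tY]] := next_label_new Y => -[st].
    by congr inr; apply: val_inj; rewrite -sX -tY st.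
- case=> [x|X]; first exact: lab_valid.
  have [s [-> szs chs _]] := next_label_new X.
  by rewrite /valid chs andbT -size_eq0 szs.
- case=> [x|X]; first by rewrite /= (lab_level labH).
  by have [s [-> szs _ _]] := next_label_new X; rewrite /= szs.
- move=> c vc; rewrite leq_eqVlt ltnS => /predU1P[|lc].
    case: c vc => [[v|C]|s] //= /andP[_ chs] [szs].
    pose X : {X | X \in max_elements (Vstar H)} :=
      exist _ (below lab s) (below_max chs szs).
    exists (inr X); have [t [-> szt cht tX]] := next_label_new X.
    by congr inr; apply: (sub_below_eq labH); rewrite // tX.
  by have [x <-] := lab_surj labH vc lc; exists (inl x).
- case=> [x|X] [y|Y]; first by rewrite /= (lab_adj labH).
  + have [s [labX szs chs sX]] := next_label_new Y.
    rewrite labX /= -sX inE /cadj.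
    case: (boolP (lower (inr s) _)); rewrite ?orbF //.
    move/(lower_level (lab_valid labH x)); rewrite -(lab_level labH) /= szs.
    by rewrite ltnNge ltnW.
  + have [s [labX szs chs sX]] := next_label_new X.
    rewrite labX /= -sX inE /cadj.
    case: (boolP (lower (inr s) _)) => //.
    move/(lower_level (lab_valid labH y)); rewrite -(lab_level labH) /= szs.
    by rewrite ltnNge ltnW.
  + have [s [-> szs chs _]] := next_label_new X.
    have [t [-> szt cht _]] := next_label_new Y.
    by rewrite /= /cadj /= szs szt ltnn.
- by move=> u; rewrite /= (lab_base labH).
Qed.

End NextStage.

Lemma B_labelled :
  @labelled 0 (@Stage T e 2 (B_graph e) (fun u => u)) (fun u => inl u).
Proof.
split=> //; first by move=> u v [].
- by move=> [u|s] //=; [exists u | case: s].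
- by move=> [v|C] [w|D]; rewrite /cadj //= orbF.
Qed.

(** If the series stops, the target of the bijection must be empty too: a chain of the next length
    would give a maximal clean set and make the factorisation effective. *)
Lemma clean_series_labelled n :
  if clean_series e n.+1 is Some H then
    exists lab : H -> code e, @labelled n H lab
  else forall s, chain e s -> size s <> n.
Proof.
elim: n => [|n]; first by exists (fun u => inl u); apply: B_labelled.
have -> : clean_series e n.+2 =
  obind (@next_stage _ e _) (clean_series e n.+1) by [].
case: (clean_series e n.+1) => [H [lab labH]|IH] /=; last first.
  (* After an earlier stop, already the truncation of the chain to length [n] is impossible. *)
  move=> s chs szs; apply: (IH (take n s)); first exact: chain_take.
  by rewrite size_takel ?szs.
rewrite /next_stage; case: ifP => [_|/negbFE/eqP eff].
  by exists (next_label lab); apply: next_labelled.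
move=> s chs szs; have := below_max labH chs szs.
by rewrite eff inE.
Qed.

(** * The characterising sequence of a vertex is its chain *)

Section CharacterisingSequence.
Variables (n : nat) (H : stage e n.+2) (lab : H -> code e).
Hypothesis labH : labelled lab.

Lemma nbh_verticesE x s : lab x = inr s -> nbh_vertices x = nth set0 s 0.
Proof.
move=> labx; apply/setP=> v.
rewrite inE in_setI (mem_lvl labH) inE (lab_adj labH) (lab_base labH) labx.
by rewrite /cadj /= andbT.
Qed.

Lemma nbh_cliquesE x s : lab x = inr s -> nbh_cliques x = Kof e (last set0 s).
Proof.
move=> labx; apply/setP=> v.
rewrite inE in_setI (mem_lvl labH) inE (lab_adj labH) (lab_base labH) labx.
by rewrite /cadj /= andbT inE.
Qed.

Lemma the_O_Kof O : O \in Ocal e -> the_O (Kof e O) = O.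
Proof.
rewrite inE => /andP[OO _]; rewrite /the_O;
case: pickP => [O' /andP[OO' /eqP eqK]|/(_ O)].
  exact: Kof_inj eqK.
by rewrite /= OO eqxx.
Qed.

(** For positive [j], the neighbours on level [j.+1] are chains whose last entry [S] lies between
    the entries [j.-1] and [j] of [s], and their cliques are [Kof e S]. The largest choice of [S],
    entry [j] itself, gives the fewest cliques, hence the intersection. *)
Lemma O_atE x s j : x \in lvl H n.+1 -> lab x = inr s -> j < size s ->
  O_at j.+1 x = nth set0 s j.
Proof.
move=> xtop labx; case: j => [|j] js; first exact: nbh_verticesE.
have chs : chain e s by have := lab_valid labH x; rewrite labx => /andP[].
rewrite /O_at /= -[RHS](the_O_Kof (chain_nth chs js)); congr the_O.
have szs : size s = n.
  by move: xtop; rewrite (mem_lvl labH) labx => /eqP[].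
have nbhE y :
    (y \in nbh_lvl j.+2 x) = (clevel (lab y) == j.+2) && lower (lab y) (inr s).
  by rewrite in_setI (mem_lvl labH) (mem_nbh_top labH) // labx andbC.
apply/eqP; rewrite eqEsubset; apply/andP; split; last first.
  apply/bigcapsP=> y; rewrite nbhE.
  case laby: (lab y) => [[v|C]|t] // => /andP[/eqP[szt]].
  case/and4P=> _ _ _; rewrite (nbh_cliquesE laby) szt; exact: Kof_sub.
have jn : j <= n by rewrite -szs; do 2!apply: ltnW.
have szj : size (take j s) = j by rewrite size_takel // szs.
have sub_j : nth set0 s j \subset nth set0 s j.+1 /\
    chain e (rcons (take j s) (nth set0 s j.+1)).
  have := chain_take j.+2 chs.
  rewrite (take_nth set0) // (take_nth set0) ?(ltnW js) // => ch.
  split; last exact: chain_rcons2_drop ch.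
  by move: ch; rewrite chain_rcons2 => /and3P[_ _ /proper_sub].
have [||y laby] :=
  lab_surj labH (c := inr (rcons (take j s) (nth set0 s j.+1))).
- by rewrite valid_rcons; case: sub_j.
- by rewrite /= size_rcons szj ltnS -szs ltnW.
have <- : nbh_cliques y = Kof e (nth set0 s j.+1).
  by rewrite (nbh_cliquesE laby) last_rcons.
apply: bigcap_inf; rewrite nbhE laby lower_rcons szj js eqxx subxx andbT /=.
by rewrite size_rcons szj eqxx; case: sub_j.
Qed.

Lemma charseqE x s : x \in lvl H n.+1 -> lab x = inr s ->
  stage_charseq n.+1 x = s :> seq {set T}.
Proof.
move=> xtop labx; have szs : size s = n.
  by move: xtop; rewrite (mem_lvl labH) labx => /eqP[].
apply: (@eq_from_nth _ set0) => [|i]; rewrite size_tuple ?szs // => ltin.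
have := tnth_mktuple (fun j : 'I_n => O_at j.+1 x) (Ordinal ltin).
rewrite (tnth_nth set0) /= => ->.
by apply: O_atE; rewrite ?szs.
Qed.

End CharacterisingSequence.
End Labels.

Theorem theorem1 (T : finType) (e : rel T)
    (e_sym : symmetric e) (e_irr : irreflexive e) (k : nat) (k_ge2 : 2 <= k) :
  [/\ (forall x : series_level e k, charseq x \in O_chains e k.-1),
      injective (@charseq T e k)
    & (forall s : k.-1.-tuple {set T},
         s \in O_chains e k.-1 -> exists x : series_level e k, charseq x = s)].
Proof.
case: k k_ge2 => [|[|n]] // _; rewrite /series_level /charseq.
have := clean_series_labelled e n.+1; move: (clean_series e n.+2).
case=> [H [lab labH]|no_chain]; last first.
  (* The series has stopped: the level is empty, and so is the set of chains of length [n.+1]. *)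
  split=> [[]|[]|s] //; rewrite inE => chs.
  by case: (no_chain s chs); rewrite size_tuple.
(* On the top level the label is the characterising sequence, so the three claims reduce to
   validity, injectivity and surjectivity of the labelling. *)
have code_top (x : {x : H | x \in lvl H n.+2}) :
    lab (val x) = inr (tval (stage_charseq n.+2 (val x))).
  have := valP x; rewrite (mem_lvl labH).
  case labx: (lab (val x)) => [[v|C]|s] // _.
  by rewrite (charseqE labH (valP x) labx).
split=> [x|x y|s] /=.
- have := lab_valid labH (val x); rewrite code_top inE => /andP[_].
  exact.
- move=> xy; apply: val_inj; apply: (lab_inj labH).
  by rewrite !code_top xy.
rewrite inE => chs.
have [||x labx] := lab_surj labH (c := inr (tval s)).
- by rewrite /= -size_eq0 size_tuple.
- by rewrite /= size_tuple.
have xtop : x \in lvl H n.+2 by rewrite (mem_lvl labH) labx /= size_tuple.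
by exists (exist _ x xtop); apply/val_inj/(charseqE labH xtop labx).
Qed.
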